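(* Let $d\ge1$, let $M\in\mathrm{Mat}(d,\mathbb{Z})$, and suppose that $D:=\det(M)\neq 0$. Then the Artin-Mazur zeta function $\zeta_M$ of the toral endomorphism defined by $M$, viewed as a rational function, satisfies the functional equation $$\zeta_M\Bigl(\frac{1}{Dz}\Bigr)=B^{\varepsilon}\,\bigl(\zeta_M(z)\bigr)^{(-1)^d},$$ where $B=D$ for $d=1$ and $B=1$ otherwise, and where $\varepsilon\in\{1,-1\}$ is the sign attached to $M$ in the context.
   Context: $M$ acts on $\mathbb{T}^d=\mathbb{R}^d/\mathbb{Z}^d$ by $x\mapsto Mx\bmod 1$. For $m\ge1$, $a_m$ is the number of isolated fixed points of $M^m$ on $\mathbb{T}^d$ (points that are isolated in the set of all fixed points of $M^m$). The Artin-Mazur zeta function is $\zeta_M(z)=\exp\bigl(\sum_{m=1}^{\infty}\frac{a_m}{m}z^m\bigr)$; this power series is the expansion at $0$ of a rational function, which is also denoted $\zeta_M(z)$. The sign $\varepsilon$ is defined as follows. Write $\det(x\mathbb{1}-M)=(x-1)^{\sigma}(x+1)^{\tau}Q(x)$ with integers $\sigma,\tau\ge0$ and $Q\in\mathbb{Z}[x]$, $Q(1)\neq0$, $Q(-1)\ne0$, where $\mathbb{1}$ is the identity matrix. Put $$\delta=\operatorname{sgn}\left(\frac{\det(x\mathbb{1}+M)}{(x-1)^{\tau}}\bigg|_{x=1}\right),\qquad \varepsilon=\delta\,\operatorname{sgn}\left(\frac{\det(x\mathbb{1}-M)}{(x-1)^{\sigma}}\bigg|_{x=1}\right),$$ where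 the quotients are polynomials in $x$ that are nonzero at $x=1$. *)

(* Defs.v *)
From HB Require Import structures.
From mathcomp Require Import all_boot all_order all_algebra.
From mathcomp Require Import finmap.
From mathcomp Require Import all_classical reals topology normedtype.

Set Implicit Arguments.
Unset Strict Implicit.
Unset Printing Implicit Defensive.

Import Order.TTheory GRing.Theory Num.Theory.
Import numFieldNormedType.Exports.

Local Open Scope classical_set_scope.
Local Open Scope quotient_scope.
Local Open Scope ring_scope.

Definition int_congr (R : realType) (d : nat) (x y : 'cV[R]_d) : bool :=
  [forall i, x i 0 - y i 0 \is a Num.int].

Lemma int_congr_refl (R : realType) (d : nat) : reflexive (@int_congr R d).
Proof. by move=> x; apply/forallP => i; rewrite subrr rpred0. Qed.

Lemma int_congr_sym (R : realType) (d : nat) : symmetric (@int_congr R d).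
Proof. by move=> x y; apply/eq_forallb => i; rewrite -opprB rpredN. Qed.

Lemma int_congr_trans (R : realType) (d : nat) : transitive (@int_congr R d).
Proof.
move=> y x z /forallP xy /forallP yz; apply/forallP => i.
by rewrite -(subrKA (y i 0)) rpredD.
Qed.

Canonical int_congr_equiv (R : realType) (d : nat) :=
  EquivRel (@int_congr R d) (@int_congr_refl R d) (@int_congr_sym R d)
    (@int_congr_trans R d).

Notation torus R d := (quotient_topology {eq_quot (int_congr_equiv R d)}).

Definition toral_endo (R : realType) (d : nat) (M : 'M[int]_d)
    (x : torus R d) : torus R d :=
  \pi_(torus R d) (map_mx intr M *m repr x).

(* The choice of representative in [toral_endo] is immaterial. *)
Lemma toral_endo_pi (R : realType) (d : nat) (M : 'M[int]_d) (x : 'cV[R]_d) :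
  toral_endo M (\pi_(torus R d) x) = \pi_(torus R d) (map_mx intr M *m x).
Proof.
have congrP (u v : 'cV[R]_d) :
    \pi_(torus R d) u = \pi_(torus R d) v <-> int_congr u v.
  exact: (rwP (@eqmodP _ (int_congr_equiv R d) u v)).
apply/congrP/forallP => i.
have /congrP/forallP xr := reprK (\pi_(torus R d) x).
rewrite !mxE -sumrB rpred_sum // => j _.
by rewrite -mulrBr rpredM // mxE intr_int.
Qed.

(* Number of isolated points of the fixed point set of M^m on the torus.
   The set of isolated fixed points is always finite; [fset_set] would give
   the empty set on an infinite one. *)
Definition num_isolated_fix (R : realType) (d : nat) (M : 'M[int]_d)
    (m : nat) : nat :=
  #|` fset_set (isolated [set x : torus R d | toral_endo (M ^+ m) x = x]) |.

(* Formal power series over a ring are coefficient sequences. *)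
Definition ps_mul (K : nzRingType) (f g : nat -> K) (n : nat) : K :=
  \sum_(i < n.+1) f i * g (n - i)%N.

Definition ps_one (K : nzRingType) (n : nat) : K := (n == 0%N)%:R.

(* exp f = sum_k f^k / k!, for f with zero constant term: then f^k only
   contributes to coefficients of index at least k, so the sum defining the
   n-th coefficient stops at k = n. *)
Definition ps_exp (K : fieldType) (f : nat -> K) (n : nat) : K :=
  \sum_(k < n.+1) iter k (ps_mul f) (@ps_one K) n / (k`!)%:R.

Definition zeta_series (R : realType) (d : nat) (M : 'M[int]_d) : nat -> rat :=
  ps_exp (fun m => if m == 0%N then 0 else (num_isolated_fix R M m)%:R / m%:R).

Reserved Notation "x %:F" (format "x %:F").
Notation "x %:F" := (FracField.tofrac x) : ring_scope.

(* The sequence s is the Taylor expansion at 0 of the rational function F,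
   which is regular at 0. *)
Definition expansion_at0 (K : fieldType) (F : {fraction {poly K}})
    (s : nat -> K) : Prop :=
  exists p q : {poly K},
    [/\ q.[0] != 0, F = p%:F / q%:F
      & forall n, ps_mul (fun i => q`_i) s n = p`_n].

(* The rational function F(G(z)); G must not be a constant, so that the
   denominator of F does not vanish at G and the result does not depend on the
   chosen numerator and denominator of F. *)
Definition frac_comp (K : fieldType) (F G : {fraction {poly K}}) :
    {fraction {poly K}} :=
  (map_poly (fun c : K => c%:P%:F) \n_(repr F)).[G] /
  (map_poly (fun c : K => c%:P%:F) \d_(repr F)).[G].

Definition char_poly_plus (d : nat) (M : 'M[int]_d) : {poly int} :=
  \det ('X%:M + map_mx polyC M).

(* sgn of p(x) / (x - 1)^k at x = 1. Division by the monic polynomial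
   (x - 1)^k is genuine Euclidean division over int. *)
Definition sgn_quot_at1 (p : {poly int}) (k : nat) : int :=
  sgz (p %/ ('X - 1%:P) ^+ k).[1].

(* delta and epsilon; sigma and tau are the multiplicities of 1 and -1 as
   roots of [char_poly M]. *)
Definition zeta_delta (d : nat) (M : 'M[int]_d) (tau : nat) : int :=
  sgn_quot_at1 (char_poly_plus M) tau.

Definition zeta_eps (d : nat) (M : 'M[int]_d) (sigma tau : nat) : int :=
  zeta_delta M tau * sgn_quot_at1 (char_poly M) sigma.

(* Main.v *)
Require Import Defs.
From HB Require Import structures.
From mathcomp Require Import all_boot all_order all_algebra all_field.
From mathcomp Require Import finmap.
From mathcomp Require Import all_classical reals topology normedtype.
From mathcomp Require Import ring zify.

Set Implicit Arguments.
Unset Strict Implicit.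
Unset Printing Implicit Defensive.

Import Order.TTheory GRing.Theory Num.Theory.

Local Open Scope ring_scope.

(** Everything rests on an explicit product for the zeta function.

    Counting.  A point x of the torus is fixed by M^m iff (M^m - 1) x is an
    integer vector.  If M^m - 1 is singular, a fixed point can be moved along
    a kernel line, so no fixed point is isolated; otherwise all of them are,
    and Smith normal form counts |det (M^m - 1)| of them.  In both cases
    a_m = |det (1 - M^m)| ([num_isolated_fixE]).

    Signs.  Up to a sign, det (1 - M^m) is the product of the values of the
    characteristic polynomial at the m-th roots of unity.  Conjugate roots
    give conjugate values, hence nonnegative products, so only the roots 1
    and -1 matter: a nonzero det (1 - M^m) has the sign of det (1 - M) for odd
    m and of det (1 - M) det (1 + M) for even m.  This yields
    a_m = eps delta^m det (1 - M^m), also when the determinant vanishes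
    ([abs_det_1sub_exp]).

    Product formula.  Let lam_i be the complex eigenvalues of M, lam_S the
    product of lam_i over i in S, and c_S = eps (-1)^|S|.  Expanding
    det (1 - M^m) = prod_i (1 - lam_i^m) gives
    a_m = sum_S c_S (delta lam_S)^m, so that the zeta series is the expansion
    of prod_S (1 - delta lam_S z)^(- c_S) ([ps_exp_powersum],
    [zeta_series_algC]).

    Rationality.  This quotient has algebraic coefficients, whereas the
    series is rational.  Applying to the identity U s = P, coefficient by
    coefficient, a Q-linear functional on a number field that does not kill
    the constant term of U produces a rational numerator and denominator
    ([rational_of_algC_expansion]).

    Functional equation.  Since lam_S lam_(complement of S) = D, the factor
    of the complement of S at 1/(Dz) is
    (- delta / z) lam_S^-1 (1 - delta lam_S z), and c changes by (-1)^d under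
    complementation.  The powers of - delta / z cancel because sum_S c_S = 0,
    and the exponent of lam_i, the sum of c_S over S containing i, vanishes
    unless d = 1, when it is - eps.  What remains is the stated equation
    ([zeta_prod_functional]).  It holds at all but finitely many complex
    points, hence for rational functions ([functional_equation]). *)

(** * Isolated fixed points on the torus *)

Section Torus.
Import numFieldNormedType.Exports.
Local Open Scope classical_set_scope.
Local Open Scope quotient_scope.
Variables (R : realType) (d : nat).

Local Notation proj R d := (\pi_(torus R d)).

Implicit Types (u v : 'cV[R]_d) (M : 'M[int]_d).

Definition int_vec u := [forall i, u i 0 \is a Num.int].

Lemma proj_eq u v : (proj R d u = proj R d v) <-> int_vec (u - v).
Proof.
rewrite /int_vec.
have -> : [forall i, (u - v) i 0 \is a Num.int] = int_congr u v.
  by apply: eq_forallb => i; rewrite !mxE.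
exact: (rwP (@eqmodP _ (int_congr_equiv R d) u v)).
Qed.

Lemma toral_endo_fix M u :
  toral_endo M (proj R d u) = proj R d u <-> int_vec (map_mx intr (M - 1) *m u).
Proof.
by rewrite toral_endo_pi proj_eq raddfB /= map_mx1 mulmxBl mul1mx.
Qed.

Lemma int_vecM M u : int_vec u -> int_vec (map_mx intr M *m u).
Proof.
move=> /forallP ui; apply/forallP => i; rewrite !mxE rpred_sum // => j _.
by rewrite rpredM // mxE intr_int.
Qed.

Lemma int_vecD u v : int_vec u -> int_vec v -> int_vec (u + v).
Proof.
by move=> /forallP ui /forallP vi; apply/forallP => i; rewrite !mxE rpredD.
Qed.

Lemma int_vecN u : int_vec (- u) = int_vec u.
Proof. by apply: eq_forallb => i; rewrite !mxE rpredN. Qed.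

Lemma int_vec_small u : int_vec u -> (forall i, `|u i 0| < 1) -> u = 0.
Proof.
move=> /forallP ui us; apply/colP => i; rewrite [RHS]mxE.
apply/eqP; rewrite -normr_eq0; have /intrP[k uk] := ui i.
have := us i; rewrite uk -intr_norm ltrz1 intr_eq0 => k1.
by rewrite (_ : `|k| = 0)//; apply/eqP; rewrite eq_le normr_ge0 -ltzD1 add0r k1.
Qed.

Let fixset M := [set x : torus R d | toral_endo M x = x].

(** Translating a fixed point by small multiples of a real kernel vector of
    M - 1 gives other fixed points arbitrarily close to it. *)
Lemma isolated_singular M : \det (M - 1) = 0 -> isolated (fixset M) = set0.
Proof.
move=> dM; apply/seteqP; split => // x [/set_mem xF [V Vx VF]].
have : \det (map_mx intr (M - 1) : 'M[R]_d)^T = 0.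
  by rewrite det_tr det_map_mx dM.
move=> /eqP/det0P[w w0 wM].
pose v := w^T; have v0 : v != 0 by rewrite -trmx0 (can_eq trmxK).
have Mv : map_mx intr (M - 1) *m v = 0.
  by rewrite -[LHS]trmxK trmx_mul trmxK wM trmx0.
pose g (t : R) : torus R d := proj R d (repr x + t *: v).
have g0 : g 0 = x by rewrite /g scale0r addr0 reprK.
have gF t : fixset M (g t).
  apply/toral_endo_fix; rewrite mulmxDr -scalemxAr Mv scaler0 addr0.
  by apply/toral_endo_fix; rewrite reprK.
have gc : {for 0, continuous g}.
  apply: continuous_comp; last exact: pi_continuous.
  by apply: cvgD; [exact: cvg_cst | apply: scalel_continuous].
have [i vi] : exists i, v i 0 != 0.
  apply/existsP; apply: contraR v0 => /existsPn v0; apply/eqP/colP => i.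
  by rewrite [RHS]mxE; apply/eqP/negPn; exact: v0.
have nV : nbhs (0 : R) (g @^-1` V) by apply: gc; rewrite g0.
have [e e0 eV] : exists2 e : R, 0 < e & forall t, `|t| < e -> V (g t).
  have /nbhs_ballP[e /= e0 eV] := nV; exists e => // t te; apply: eV.
  by rewrite -ball_normE /= sub0r normrN.
(* Small enough to stay in V and to keep the nonzero entry t * v i 0 in the
   open interval of radius 1 around 0. *)
pose t := Num.min (e / 2) ((2 * `|v i 0|)^-1).
have vi0 : 0 < `|v i 0| by rewrite normr_gt0.
have t0 : 0 < t by rewrite lt_min divr_gt0 //= invr_gt0 mulr_gt0.
have te : `|t| < e.
  rewrite gtr0_norm // (le_lt_trans (y := e / 2)) ?ge_min ?lexx //.
  by rewrite ltr_pdivrMr // mulr2n mulrDr mulr1 ltrDl.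
have gx : g t = x.
  have : (V `&` fixset M) (g t) by split; [exact: eV | exact: gF].
  by rewrite VF.
have /forallP/(_ i) : int_vec (t *: v).
  by rewrite -[t *: v](addKr (repr x)) addrC; apply/proj_eq; rewrite reprK.
rewrite mxE => /intrP[k tk].
have : `|t * v i 0| < 1.
  rewrite normrM gtr0_norm //.
  rewrite (le_lt_trans (y := (2 * `|v i 0|)^-1 * `|v i 0|)) //.
    by rewrite ler_pM2r // ge_min lexx orbT.
  by rewrite invfM mulfVK ?gt_eqF // invf_lt1 // ltr1n.
rewrite tk -intr_norm ltrz1 => k1.
have k0 : k = 0 by apply/eqP; rewrite -normr_eq0; lia.
by move: tk; rewrite k0 => /eqP; rewrite mulf_eq0 (negPf vi) gt_eqF.
Qed.

(** The preimage of this set is the union of the balls centred at the integer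
    translates of u. *)
Lemma proj_ball_open (u : 'cV[R]_d) (r : R) :
  open [set proj R d v | v in ball u r].
Proof.
rewrite /open /= /quotient_open.
suff -> : proj R d @^-1` [set proj R d v | v in ball u r] =
    \bigcup_(k in [set k | int_vec k]) ball (u + k) r.
  by apply: bigcup_open => k _; exact: ball_open.
have shift k y : ball (u + k) r y = ball u r (y - k).
  by rewrite -ball_normE /= opprB addrA.
apply/seteqP; split=> [y [v uv /proj_eq vy]|y [k /= kI]].
  exists (y - v); first by rewrite /= -int_vecN opprB.
  by rewrite shift opprB addrC subrK.
rewrite shift => uyk; exists (y - k) => //.
by apply/proj_eq; rewrite addrAC subrr add0r int_vecN.
Qed.

(** On a small enough box the image under M has entries less than 1 in
    absolute value, and 0 is the only such integer vector. *)
Lemma int_vec_mul_small M : exists2 r : R, 0 < r & forall u,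
  (forall i, `|u i 0| < r) -> int_vec (map_mx intr M *m u) ->
  map_mx intr M *m u = 0.
Proof.
pose C : R := 1 + \sum_i \sum_j `|(M i j)%:~R|.
have C0 : 0 < C.
  by rewrite ltr_wpDr // sumr_ge0 // => i _; rewrite sumr_ge0.
exists C^-1; rewrite ?invr_gt0 // => u ur Mu; apply: int_vec_small Mu _ => i.
rewrite mxE; apply: le_lt_trans (ler_norm_sum _ _ _) _.
apply: (@le_lt_trans _ _ ((\sum_j `|(M i j)%:~R|) * C^-1)).
  rewrite mulr_suml ler_sum // => j _.
  by rewrite normrM mxE ler_wpM2l // ltW.
rewrite ltr_pdivrMr // mul1r /C.
rewrite [ltRHS](_ : _ = \sum_j `|(M i j)%:~R| +
  (1 + \sum_(k | k != i) \sum_j `|(M k j)%:~R|)); last first.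
  by rewrite (bigD1 i) //= addrCA.
by rewrite ltrDl ltr_wpDr // sumr_ge0 // => k _; rewrite sumr_ge0.
Qed.

Lemma isolated_regular M : \det (M - 1) != 0 -> isolated (fixset M) = fixset M.
Proof.
move=> dM; apply/seteqP; split; first exact: isolatedS.
move=> x xF; split; first exact/mem_set.
have [r r0 small] := int_vec_mul_small (M - 1).
exists [set proj R d v | v in ball (repr x) r].
  apply: open_nbhs_nbhs; split; first exact: proj_ball_open.
  by exists (repr x); [exact: ballxx | exact: reprK].
apply/seteqP; split=> [y [[v [_ xv] <-] /toral_endo_fix vF]|_ ->]; last first.
  by split => //; exists (repr x); [exact: ballxx | exact: reprK].
have xF' : int_vec (map_mx intr (M - 1) *m repr x).
  by apply/toral_endo_fix; rewrite reprK.
have : map_mx intr (M - 1) *m (v - repr x) = 0.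
  apply: small; last by rewrite mulmxBr int_vecD // int_vecN.
  by move=> i; rewrite !mxE distrC; exact: xv.
have Mu : (map_mx intr (M - 1) : 'M[R]_d) \in unitmx.
  by rewrite unitmxE det_map_mx unitfE intr_eq0.
move=> /(congr1 (mulmx (invmx (map_mx intr (M - 1))))).
by rewrite mulKmx // mulmx0 => /eqP; rewrite subr_eq0 => /eqP ->; exact: reprK.
Qed.

(** By Smith normal form M = L diag(e) P with L and P unimodular.  Up to the
    torus automorphism P, the kernel of M on the torus is that of diag(e),
    whose points are the vectors (k_i / e_i) with 0 <= k_i < |e_i|. *)
Lemma torus_kernel_card M : \det M != 0 ->
  #|` fset_set [set x : torus R d | int_vec (map_mx intr M *m repr x)] | =
  `|\det M|%N.
Proof.
move=> dM.
have [L uL [P uP [s _ sM]]] := int_Smith_normal_form M.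
pose e (i : 'I_d) : int := s`_i.
have detU (U : 'M[int]_d) : U \in unitmx -> `|\det U|%N = 1%N.
  by rewrite unitmxE unfold_in => /orP[]/eqP->.
have sdiag : \matrix_(i, j) (s`_i *+ (i == j :> nat)) = diag_mx (\row_i e i).
  by apply/matrixP => i j; rewrite !mxE.
have detM : `|\det M|%N = (\prod_i `|e i|)%N.
  rewrite sM sdiag !det_mulmx det_diag !abszM !detU // mul1n muln1.
  rewrite (big_morph absz abszM absz1).
  by apply: eq_bigr => i _; rewrite mxE.
have e0 i : `|e i|%N != 0%N.
  have: (\prod_i `|e i| != 0)%N by rewrite -detM absz_eq0.
  by apply: contra => /eqP ei; rewrite (bigD1 i) //= ei mul0n.
pose c (k : {dffun forall i, 'I_(`|e i|)}) : 'cV[R]_d :=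
  \col_i ((k i)%:Z%:~R / (e i)%:~R).
pose f k : torus R d := proj R d (map_mx intr (invmx P) *m c k).
have eR0 i : (e i)%:~R != 0 :> R by rewrite intr_eq0 -absz_eq0.
have mapK (U : 'M[int]_d) (u : 'cV[R]_d) : U \in unitmx ->
    map_mx intr U *m (map_mx intr (invmx U) *m u) = u.
  by move=> uU; rewrite mulmxA -map_mxM mulmxV // map_mx1 mul1mx.
have mapKV (U : 'M[int]_d) (u : 'cV[R]_d) : U \in unitmx ->
    map_mx intr (invmx U) *m (map_mx intr U *m u) = u.
  by move=> uU; rewrite mulmxA -map_mxM mulVmx // map_mx1 mul1mx.
have int_unit (U : 'M[int]_d) (u : 'cV[R]_d) : U \in unitmx ->
    int_vec (map_mx intr U *m u) -> int_vec u.
  by move=> uU Uu; rewrite -(mapKV U u uU) int_vecM.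
have f_inj : injective f.
  move=> k l /proj_eq; rewrite -mulmxBr => /int_unit; rewrite unitmx_inv.
  move=> /(_ uP)/int_vec_small kl0; apply/ffunP => i; apply/val_inj/eqP.
  rewrite -eqz_nat -(eqr_int R) -subr_eq0.
  rewrite -(mulIr_eq0 _ (mulIf (invr_neq0 (eR0 i)))).
  apply/eqP; have /colP/(_ i) : c k - c l = 0.
    apply: kl0 => j; rewrite !mxE -mulrBl normrM normfV.
    rewrite ltr_pdivrMr ?normr_gt0 // mul1r -intrB -!intr_norm ltr_int.
    by have := ltn_ord (k j); have := ltn_ord (l j); lia.
  by rewrite !mxE mulrBl.
have -> : [set x : torus R d | int_vec (map_mx intr M *m repr x)] =
    [set` [fset f k | k in {dffun forall i, 'I_(`|e i|)}]%fset].
  apply/seteqP; split => x /=.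
    rewrite sM sdiag !map_mxM -!mulmxA => /(int_unit _ _ uL).
    set w := map_mx intr P *m repr x; rewrite map_diag_mx mul_diag_mx.
    move=> /forallP wI.
    have /fin_all_exists[n wn] i : exists n : int, (e i)%:~R * w i 0 = n%:~R.
      by have /intrP[n] := wI i; rewrite !mxE => wn; exists n.
    have nlt i : (`|(n i %% e i)%Z| < `|e i|)%N.
      have ei : e i != 0 by rewrite -absz_eq0.
      by rewrite -ltz_nat gez0_abs ?modz_ge0 // abszE ltz_mod.
    apply/imfsetP; exists (finfun (fun i => Ordinal (nlt i))) => //.
    rewrite -[LHS]reprK; apply/proj_eq.
    rewrite -(mapKV P (repr x) uP) -mulmxBr int_vecM //.
    apply/forallP => i; rewrite mxE [X in _ + X]mxE [X in - X]mxE ffunE /=.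
    have ei : e i != 0 by rewrite -absz_eq0.
    have -> : w i 0 = (n i)%:~R / (e i)%:~R by rewrite -wn mulrC mulKf.
    rewrite gez0_abs ?modz_ge0 // -mulrBl -intrB.
    by rewrite {1}(divz_eq (n i) (e i)) addrK intrM mulfK // intr_int.
  move=> /imfsetP[k _ ->].
  have : int_vec (map_mx intr M *m (map_mx intr (invmx P) *m c k)).
    rewrite sM sdiag !map_mxM -!mulmxA mapK // int_vecM //.
    apply/forallP => i; rewrite map_diag_mx mul_diag_mx !mxE.
    by rewrite mulrC divfK // intr_int.
  have /proj_eq/(int_vecM M) : proj R d (repr (f k)) = f k by rewrite reprK.
  by rewrite mulmxBr => /int_vecD/[apply]; rewrite subrK.
rewrite set_fsetK card_imfset //= -cardE detM card_dep_ffun foldrE.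
rewrite big_map.
by rewrite big_enum /=; apply: eq_bigr => i _; rewrite card_ord.
Qed.

Lemma num_isolated_fixE M m : num_isolated_fix R M m = `|\det (1 - M ^+ m)|%N.
Proof.
have -> : `|\det (1 - M ^+ m)|%N = `|\det (M ^+ m - 1)|%N.
  by rewrite -opprB -scaleN1r detZ abszM abszX /= exp1n mul1n.
rewrite /num_isolated_fix -/(fixset _).
have [d0|d0] := eqVneq (\det (M ^+ m - 1)) 0.
  by rewrite isolated_singular // d0 fset_set0 cardfs0.
rewrite isolated_regular // -torus_kernel_card //; congr (#|` fset_set _|).
apply/seteqP; split => x /=; rewrite -{1 2}(reprK x).
  by move=> /toral_endo_fix; rewrite reprK.
by move=> xI; apply/toral_endo_fix; move: xI; rewrite reprK.
Qed.

End Torus.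

(** * The sign of det (1 - M^m) *)

Lemma horner_char_poly (K : comNzRingType) (n : nat) (A : 'M[K]_n) (c : K) :
  (char_poly A).[c] = \det (c%:M - A).
Proof.
rewrite -/(horner_eval c _) /char_poly -det_map_mx; congr (\det _).
apply/matrixP => i j; rewrite !mxE /= horner_evalE.
by rewrite hornerD hornerN hornerC hornerMn hornerX.
Qed.

(** The factorisation of X^m - 1 over the m-th roots of unity, evaluated
    at A. *)
Lemma det_exp_sub1 (n : nat) (A : 'M[algC]_n) (m : nat) (w : algC) :
  m.-primitive_root w ->
  \det (A ^+ m - 1) =
    (-1) ^+ (n * m) * \prod_(0 <= j < m) (char_poly A).[w ^+ j].
Proof.
case: n A => [|n] A wm.
  rewrite det_mx00 mul0n mul1r big1 // => j _.
  by rewrite /char_poly det_mx00 hornerC.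
have -> : A ^+ m - 1 = \prod_(0 <= j < m) (A - (w ^+ j)%:M).
  have := congr1 (horner_mx A) (factor_Xn_sub_1 wm).
  rewrite rmorphB rmorphXn rmorph1 /= horner_mx_X => <-.
  rewrite rmorph_prod; apply: eq_bigr => j _.
  by rewrite rmorphB /= horner_mx_X horner_mx_C.
have -> : (-1) ^+ (n.+1 * m) = \prod_(0 <= j < m) (-1) ^+ n.+1 :> algC.
  by rewrite prodr_const_nat subn0 exprM.
rewrite (big_morph _ (@det_mulmx _ _) (det1 _ _)) -big_split /=.
by apply: eq_bigr => j _; rewrite horner_char_poly -detZ scaleN1r opprB.
Qed.

Lemma eigenvalues_exist (n : nat) (A : 'M[algC]_n) :
  {lam : 'I_n -> algC | char_poly A = \prod_i ('X - (lam i)%:P)}.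
Proof.
have [r] := closed_field_poly_normal (char_poly A).
rewrite (monicP (char_poly_monic A)) scale1r => Ar.
have sr : size r = n.
  by have := size_char_poly A; rewrite Ar size_prod_XsubC => -[].
exists (fun i => r`_i); rewrite Ar (big_nth 0) big_mkord sr.
by [].
Qed.

(** In [det_exp_sub1] the factors that belong to one eigenvalue multiply to
    lam_i^m - 1 up to sign, by the factorisation of X^m - 1 at lam_i. *)
Lemma det_1sub_exp (n : nat) (A : 'M[algC]_n) (lam : 'I_n -> algC) (m : nat) :
  char_poly A = \prod_i ('X - (lam i)%:P) -> (0 < m)%N ->
  \det (1 - A ^+ m) = \prod_i (1 - lam i ^+ m).
Proof.
move=> Alam m0; have [w wm] := C_prim_root_exists m0.
rewrite -opprB -scaleN1r detZ (det_exp_sub1 _ wm) Alam.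
under eq_big_nat => j _ do rewrite horner_prod.
rewrite exchange_big /= exprM.
have powE (a : algC) : a ^+ n = \prod_(i < n) a by rewrite prodr_const card_ord.
rewrite exprAC mulrA -exprMn !powE -big_split /=; apply: eq_bigr => i _.
have := congr1 (fun p => p.[lam i]) (factor_Xn_sub_1 wm).
rewrite /= horner_prod !hornerE => lm.
rewrite -[RHS]opprB -{}lm -[RHS]mulN1r -mulrA; congr (_ * _).
have -> : (-1) ^+ m = \prod_(0 <= j < m) (-1) :> algC.
  by rewrite prodr_const_nat subn0.
rewrite -big_split /=; apply: eq_bigr => j _.
by rewrite !hornerE mulN1r opprB.
Qed.

(** The factors j and 2k+1-j are conjugate and pair into squared moduli. *)
Lemma prod_conj_odd (f : nat -> algC) (k : nat) :
  (forall j, (0 < j <= k)%N -> f (k.*2.+1 - j)%N = (f j)^*) ->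
  0 <= \prod_(1 <= j < k.*2.+1) f j.
Proof.
move=> fC; rewrite (@big_cat_nat _ _ _ k.+1) //=; last first.
  by rewrite ltnS -addnn leq_addr.
rewrite [X in _ * X]big_nat_rev /= -{2}[k.+1]add1n big_addn.
have -> : (k.*2.+1 - k = k.+1)%N by lia.
rewrite -big_split big_nat /= prodr_ge0 // => j jk.
rewrite (_ : (_ - _)%N = (k.*2.+1 - j)%N) ?fC -?normCK ?exprn_ge0 //; lia.
Qed.

(** As for odd length, except that the middle factor stays unpaired. *)
Lemma prod_conj_even (f : nat -> algC) (k : nat) :
  (forall j, (0 < j <= k)%N -> f (k.+1.*2 - j)%N = (f j)^*) ->
  exists2 r, 0 <= r & \prod_(1 <= j < k.+1.*2) f j = f k.+1 * r.
Proof.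
move=> fC; exists (\prod_(1 <= j < k.+1) f j * \prod_(k.+2 <= j < k.+1.*2) f j).
  rewrite [X in _ * X]big_nat_rev /= -{1}[k.+2]add1n big_addn.
  have -> : (k.+1.*2 - k.+1 = k.+1)%N by lia.
  rewrite -big_split big_nat /= prodr_ge0 // => j jk.
  rewrite (_ : (_ - _)%N = (k.+1.*2 - j)%N) ?fC -?normCK ?exprn_ge0 //; lia.
rewrite (@big_cat_nat _ _ _ k.+1) //=; last lia.
by rewrite mulrCA [X in _ * X]big_ltn //; lia.
Qed.

Lemma map_mx_exp (K L : nzRingType) (phi : {rmorphism K -> L}) (n : nat)
    (A : 'M[K]_n) (m : nat) : map_mx phi (A ^+ m) = map_mx phi A ^+ m.
Proof. by elim: m => [|m IHm]; rewrite ?map_mx1 // !exprS map_mxM IHm. Qed.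

Section Signs.
Variables (d : nat) (M : 'M[int]_d).

Let MC : 'M[algC]_d := map_mx intr M.

Lemma char_poly_conj (z : algC) : (char_poly MC).[z^*] = ((char_poly MC).[z])^*.
Proof.
rewrite -map_char_poly -[RHS]horner_map /= -map_poly_comp.
congr (_.[_]); apply: eq_map_poly => a /=.
by rewrite rmorph_int.
Qed.

Lemma prim_root_conj (m j : nat) (w : algC) : m.-primitive_root w ->
  (j <= m)%N -> w ^+ (m - j) = (w ^+ j)^*.
Proof.
move=> wm jm; have m0 := prim_order_gt0 wm.
have w1 : `|w| = 1.
  apply/eqP; rewrite -(@pexpr_eq1 _ _ m) // -normrX.
  by rewrite prim_expr_order // normr1.
have wj0 : w ^+ j != 0 by rewrite -normr_eq0 normrX w1 expr1n oner_eq0.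
apply: (mulIf wj0); rewrite -exprD subnK // prim_expr_order //.
by rewrite mulrC -normCK normrX w1 !expr1n.
Qed.

Lemma prim_root_half (k : nat) (w : algC) : (0 < k)%N ->
  k.*2.-primitive_root w -> w ^+ k = -1.
Proof.
move=> k0 wk; have /eqP := prim_expr_order wk.
rewrite -muln2 exprM sqrf_eq1 => /orP[|/eqP//].
by rewrite -(prim_order_dvd wk) => /dvdn_leq; lia.
Qed.

(** Among the roots of unity only 1 and, for even m, -1 are real; the other
    ones contribute a nonnegative factor altogether. *)
Lemma det_1sub_exp_sign (m : nat) : (0 < m)%N -> \det (1 - M ^+ m) != 0 ->
  0 < \det (1 - M) * (if odd m then 1 else \det (1 + M)) * \det (1 - M ^+ m).
Proof.
move=> m0 D0; have [w wm] := C_prim_root_exists m0.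
pose f j := (char_poly MC).[w ^+ j].
have fC j : (j <= m)%N -> f (m - j)%N = (f j)^*.
  by move=> jm; rewrite /f (prim_root_conj wm) // char_poly_conj.
have detC (N : 'M[int]_d) : \det (map_mx intr N) = (\det N)%:~R :> algC.
  by rewrite det_map_mx.
have DE : (\det (1 - M ^+ m))%:~R = (-1) ^+ (d * m.+1) * \prod_(0 <= j < m) f j.
  rewrite -detC raddfB /= map_mx1.
  rewrite map_mx_exp -/MC.
  by rewrite -opprB -scaleN1r detZ (det_exp_sub1 _ wm) mulnS exprD mulrA.
have f0 : f 0%N = (\det (1 - M))%:~R.
  by rewrite /f expr0 horner_char_poly -detC raddfB /= map_mx1.
(* The trivial root 1, and -1 for even m, are split off; [r] collects the
   conjugate pairs. *)
have [r r0 Dr] : exists2 r : algC, 0 <= r & (\det (1 - M ^+ m))%:~R =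
    (\det (1 - M) * (if odd m then 1 else \det (1 + M)))%:~R * r.
  rewrite DE big_ltn // f0; case: ifP => mo.
    exists (\prod_(1 <= j < m) f j).
      have mk : m = m./2.*2.+1 by rewrite -[LHS]odd_double_half mo.
      by rewrite mk; apply: prod_conj_odd => j jm; rewrite -mk fC //; lia.
    by rewrite mulr1 mulnC exprM -signr_odd /= mo expr0 expr1n mul1r.
  have [k mk] : exists k, m = k.+1.*2.
    by exists m./2.-1; have := odd_double_half m; rewrite mo; lia.
  have [s s0 fs] : exists2 s, 0 <= s &
      \prod_(1 <= j < k.+1.*2) f j = f k.+1 * s.
    by apply: prod_conj_even => j jk; rewrite -mk fC //; lia.
  exists s => //; rewrite mk fs /f (prim_root_half _ (w := w)) -?mk //.
  rewrite mulnC exprM -signr_odd /= -?mk mo expr1 mulrCA intrM -[RHS]mulrA.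
  congr (_ * _); rewrite mulrA horner_char_poly -detZ -detC; congr (\det _ * _).
  rewrite scaleN1r opprB raddfD /= map_mx1.
  by rewrite (raddfN (@scalar_mx _ d)) opprK addrC.
have r1 : 0 < r.
  rewrite lt_def r0 andbT; apply: contra D0 => /eqP r0'.
  by rewrite -(intr_eq0 algC) Dr r0' mulr0.
have x0 : \det (1 - M) * (if odd m then 1 else \det (1 + M)) != 0.
  by apply: contra D0 => /eqP x0; rewrite -(intr_eq0 algC) Dr x0 mul0r.
rewrite -(ltr_int algC) intrM Dr mulrA -expr2 mulr_gt0 //.
by rewrite expr2 -intrM ltr0z -expr2 exprn_even_gt0.
Qed.

Variables (sigma tau : nat) (Q : {poly int}).
Hypothesis char_fact :
  char_poly M = ('X - 1%:P) ^+ sigma * ('X + 1%:P) ^+ tau * Q.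
Hypotheses (Q1 : Q.[1] != 0) (QN1 : Q.[-1] != 0).

Lemma sgn_quot_at1E (p : {poly int}) (k : nat) :
  sgn_quot_at1 (('X - 1%:P) ^+ k * p) k = sgz p.[1].
Proof.
by rewrite /sgn_quot_at1 Pdiv.IdomainMonic.mulKp // monic_exp ?monicXsubC.
Qed.

Lemma char_poly_plusE : char_poly_plus M = (-1) ^+ d *: (char_poly M \Po - 'X).
Proof.
rewrite /char_poly -[_ \Po _]/(comp_poly _ _) -det_map_mx -mul_polyC.
rewrite rmorphXn rmorphN1 -detZ; congr (\det _).
apply/matrixP => i j; rewrite !mxE /= rmorphB rmorphMn /= comp_polyX comp_polyC.
by rewrite mulN1r opprB mulNrn opprK addrC.
Qed.

(** The quotient of det (X + M) by (X - 1)^tau, obtained by substituting - X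
    in the factorisation of the characteristic polynomial. *)
Definition plus_cofactor : {poly int} :=
  (-1) ^+ (d + sigma + tau) *: (('X + 1%:P) ^+ sigma * (Q \Po - 'X)).

Lemma char_poly_plus_fact :
  char_poly_plus M = ('X - 1%:P) ^+ tau * plus_cofactor.
Proof.
rewrite char_poly_plusE char_fact !rmorphM !rmorphXn rmorphB rmorphD /=.
rewrite !comp_polyX !comp_polyC /plus_cofactor.
have -> : - 'X - 1%:P = -1 * ('X + 1%:P) :> {poly int} by rewrite mulN1r opprD.
have -> : - 'X + 1%:P = -1 * ('X - 1%:P) :> {poly int}.
  by rewrite mulN1r opprB addrC.
rewrite !exprMn -!mul_polyC !rmorphXn rmorphN1 !exprD.
by ring.
Qed.

Lemma sgn_unit (a : int) : a != 0 -> sgz a = 1 \/ sgz a = -1.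
Proof. by move=> a0; case: sgzP a0 => //; [left | right]. Qed.

Lemma zeta_deltaE : zeta_delta M tau = sgz plus_cofactor.[1].
Proof. by rewrite /zeta_delta char_poly_plus_fact sgn_quot_at1E. Qed.

Lemma plus_cofactor1 : plus_cofactor.[1] != 0.
Proof.
rewrite hornerZ hornerM horner_exp hornerD hornerX hornerC horner_comp.
by rewrite hornerN hornerX !mulf_neq0 ?expf_neq0.
Qed.

Lemma zeta_delta_sqr : zeta_delta M tau ^+ 2 = 1.
Proof. by rewrite zeta_deltaE; case: (sgn_unit plus_cofactor1) => ->. Qed.

Lemma zeta_epsE :
  zeta_eps M sigma tau = zeta_delta M tau * sgz (('X + 1%:P) ^+ tau * Q).[1].
Proof. by rewrite /zeta_eps char_fact -mulrA sgn_quot_at1E. Qed.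

Lemma zeta_eps_unit : zeta_eps M sigma tau = 1 \/ zeta_eps M sigma tau = -1.
Proof.
rewrite zeta_epsE zeta_deltaE -sgzM; apply: sgn_unit.
rewrite mulf_neq0 ?plus_cofactor1 // hornerM horner_exp hornerD hornerX hornerC.
by rewrite mulf_neq0 ?expf_neq0.
Qed.

(** A nonzero det (1 - M^m) forces sigma = 0, and for even m also tau = 0;
    then det (1 - M) has sign delta eps and, for even m, det (1 + M) has
    sign delta. *)
Lemma abs_det_1sub_exp (m : nat) : (0 < m)%N ->
  (`|\det (1 - M ^+ m)|%N)%:Z =
    zeta_eps M sigma tau * zeta_delta M tau ^+ m * \det (1 - M ^+ m).
Proof.
move=> m0; have [->|D0] := eqVneq (\det (1 - M ^+ m)) 0; first by rewrite mulr0.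
have := det_1sub_exp_sign m0 D0; set x := \det (1 - M) => xD.
have sg : sgz (x * (if odd m then 1 else \det (1 + M))) =
    sgz (\det (1 - M ^+ m)).
  move: xD; rewrite -sgz_gt0 sgzM.
  by case: (sgzP (\det _)) => // _; case: sgzP => //.
have xE : x = (('X - 1%:P) ^+ sigma * (('X + 1%:P) ^+ tau * Q)).[1].
  by rewrite mulrA -char_fact horner_char_poly.
have sigma0 : sigma = 0%N.
  case: sigma xE => // s xE; move: xD.
  by rewrite xE exprS !hornerM hornerXsubC subrr !mul0r ltxx.
have xs : sgz x = zeta_delta M tau * zeta_eps M sigma tau.
  by rewrite zeta_epsE mulrA -expr2 zeta_delta_sqr mul1r xE sigma0 mul1r.
have ys : ~~ odd m -> sgz (\det (1 + M)) = zeta_delta M tau.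
  move=> /negPf mo; move: xD; rewrite mo.
  have -> : \det (1 + M) = (('X - 1%:P) ^+ tau * plus_cofactor).[1].
    rewrite -char_poly_plus_fact /char_poly_plus.
    rewrite -/(horner_eval 1 _) -det_map_mx; congr (\det _).
    apply/matrixP => i j.
    by rewrite !mxE /= horner_evalE hornerD hornerC hornerMn hornerX.
  rewrite zeta_deltaE; case: tau => [|t]; first by rewrite mul1r.
  by rewrite exprS !hornerM hornerXsubC subrr !mul0r mulr0 mul0r ltxx.
rewrite abszE normrEsg.
rewrite sgrEz intz -{}sg sgzM xs; congr (_ * _).
have dE k : zeta_delta M tau ^+ k.*2 = 1.
  by rewrite -mul2n exprM zeta_delta_sqr expr1n.
rewrite -{2}(odd_double_half m) exprD dE mulr1.
case: ifP => mo; first by rewrite sgz1 mulr1 expr1 mulrC.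
by rewrite ys ?mo // expr0 mulr1 mulrAC -expr2 zeta_delta_sqr mul1r.
Qed.
End Signs.

(** * Exponentials of power sums *)

Lemma Xn_dvdP (K : fieldType) (n : nat) (p : {poly K}) :
  reflect (forall i, (i < n)%N -> p`_i = 0) ('X^n %| p).
Proof.
apply: (iffP idP) => [/dvdpP[q ->] i ilt|p0]; first by rewrite coefMXn ilt.
rewrite -(poly_take_drop n p) [take_poly n p](_ : _ = 0) ?add0r ?dvdp_mulIr //.
by apply/polyP => i; rewrite coef_take_poly coef0; case: ifP => // /p0.
Qed.

Section Series.
Variable K : numFieldType.
Implicit Types (p q : {poly K}) (f g : nat -> K) (r : seq K).

(** Uniqueness for the linear equation p y' = p' y modulo X^n: the coefficient
    of X^(j-1) determines j p_0 q_j from the lower coefficients of q. *)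
Lemma ode_unique n p q : p`_0 != 0 -> q`_0 = 0 ->
  'X^n %| p * q^`() - p^`() * q -> 'X^(n.+1) %| q.
Proof.
move=> p0 q0 /Xn_dvdP ode; apply/Xn_dvdP; elim/ltn_ind => -[//|j] IH jn.
have := ode j jn; rewrite coefB !coefM big_ord_recl /= subn0 coef_deriv.
rewrite big1 => [|i _]; last first.
  have ij := ltn_ord i.
  rewrite /bump add1n coef_deriv IH ?mul0rn ?mulr0 //; lia.
rewrite big1 => [|i _]; last by rewrite IH ?mulr0 //; lia.
by rewrite addr0 subr0 => /eqP; rewrite mulf_eq0 (negPf p0) mulrn_eq0 => /eqP.
Qed.

Definition recip_poly r : {poly K} := \prod_(a <- r) (1 - a *: 'X).

(** The logarithmic derivative of the product of the 1 - a X is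
    - sum_m (sum_a a^(m+1)) X^m; clearing denominators and truncating at X^n
    keeps the statement inside the polynomial ring. *)
Lemma recip_poly_log_deriv n r :
  'X^n %| (recip_poly r)^`() +
    (\sum_(m < n) (\sum_(a <- r) a ^+ m.+1) *: 'X^m) * recip_poly r.
Proof.
elim: r => [|a r IHr].
  rewrite /recip_poly big_nil derivC add0r mulr1 big1 ?dvdp0 // => m _.
  by rewrite big_nil scale0r.
have geom : (\sum_(m < n) a ^+ m.+1 *: 'X^m) * (1 - a *: 'X) =
    a%:P - a ^+ n.+1 *: 'X^n :> {poly K}.
  elim: n {IHr} => [|n IHn]; first by rewrite big_ord0 mul0r alg_polyC subrr.
  rewrite big_ord_recr mulrDl IHn /= -!mul_polyC !exprS !rmorphM /=.
  rewrite !rmorphXn /=.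
  by ring.
rewrite /recip_poly big_cons -/(recip_poly r) derivM.
under eq_bigr => m _ do rewrite big_cons scalerDl.
rewrite big_split /=; set A := \sum_(m < n) a ^+ _ *: _ in geom *.
set B := \sum_(m < n) _ *: _ in IHr *.
rewrite derivB derivC derivZ derivX alg_polyC sub0r.
have -> : - a%:P * recip_poly r + (1 - a *: 'X) * (recip_poly r)^`() +
     (A + B) * ((1 - a *: 'X) * recip_poly r) =
   (1 - a *: 'X) * ((recip_poly r)^`() + B * recip_poly r) +
   (A * (1 - a *: 'X) - a%:P) * recip_poly r by ring.
apply: dvdp_add; first exact: dvdp_mull.
rewrite geom addrAC subrr add0r mulNr dvdpNr dvdp_mulr //.
by rewrite -mul_polyC dvdp_mull.
Qed.

Lemma recip_poly0 r : (recip_poly r)`_0 = 1.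
Proof.
rewrite -horner_coef0 horner_prod big1 // => a _.
by rewrite hornerD hornerN hornerZ hornerX mulr0 subr0 hornerC.
Qed.

Section Exp.
Variable f : nat -> K.
Hypothesis f0 : f 0%N = 0.
Variable n : nat.

Let F : {poly K} := \poly_(i < n) f i.
Let E k : {poly K} := \sum_(i < k) i`!%:R^-1 *: F ^+ i.

Lemma ps_pow_coef k j : (j < n)%N ->
  iter k (ps_mul f) (@ps_one K) j = (F ^+ k)`_j.
Proof.
elim: k j => [|k IHk] j jn; first by rewrite expr0 coef1.
rewrite exprS coefM iterS {1}/ps_mul; apply: eq_bigr => i _.
by rewrite coef_poly IHk ?(leq_ltn_trans _ jn) ?leq_subr // -ltnS.
Qed.

Lemma XdvdF k : 'X^k %| F ^+ k.
Proof.
apply: dvdp_exp2r; rewrite -['X]expr1; apply/Xn_dvdP => -[|//] _.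
by rewrite coef_poly f0 if_same.
Qed.

(** Up to index n the exponential series agrees with the polynomial obtained
    by truncating both f and the sum of the f^k / k!, which makes the ring
    structure and the derivation of polynomials available. *)
Lemma ps_exp_coef j : (j < n)%N -> ps_exp f j = (E n)`_j.
Proof.
move=> jn; rewrite /ps_exp coef_sum.
rewrite (big_ord_widen n
  (fun k => iter k (ps_mul f) (@ps_one K) j / (k`!)%:R)) //.
rewrite big_mkcond; apply: eq_bigr => i _; rewrite ltnS coefZ mulrC.
rewrite ps_pow_coef //; case: leqP => // ji.
by have /Xn_dvdP-> := XdvdF i; rewrite ?mulr0.
Qed.

Lemma exp_trunc_deriv k : (E k.+1)^`() = F^`() * E k.
Proof.
rewrite /E big_ord_recl expr0 alg_polyC derivD derivC add0r raddf_sum mulr_sumr.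
apply: eq_bigr => i _; rewrite /= /bump add1n derivZ deriv_exp /=.
rewrite -scalerAr -mulrnAr -[_ *+ i.+1]scaler_nat -scalerAr scalerA factS.
by rewrite natrM invfM mulrAC mulVf ?mul1r // pnatr_eq0.
Qed.

(** The equation y' = f' y of the exponential. *)
Lemma exp_trunc_ode k : 'X^k %| (E k.+1)^`() - F^`() * E k.+1.
Proof.
rewrite exp_trunc_deriv /E big_ord_recr /= mulrDr opprD addNKr dvdpNr.
by rewrite -mul_polyC !dvdp_mull // XdvdF.
Qed.

(** The product of the 1 - b X with exp f and the product of the 1 - a X have
    the same logarithmic derivative and the same constant term. *)
Lemma ps_exp_powersum_trunc k rb ra : n = k.+1 ->
  (forall m, (0 < m)%N -> m%:R * f m =
     \sum_(b <- rb) b ^+ m - \sum_(a <- ra) a ^+ m) ->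
  'X^n %| recip_poly rb * E n - recip_poly ra.
Proof.
move=> nk fab; have := exp_trunc_ode k; rewrite -nk.
set G := deriv F; set W := E n => ode.
have GE : G = \sum_(m < k) (\sum_(b <- rb) b ^+ m.+1) *: 'X^m -
              \sum_(m < k) (\sum_(a <- ra) a ^+ m.+1) *: 'X^m.
  rewrite -sumrB; apply/polyP => i; rewrite coef_deriv coef_poly coef_sum nk.
  have [ik|ki] := ltnP i k.
    rewrite (bigD1 (Ordinal ik)) //= [X in _ + X]big1 => [|j ji].
    - rewrite addr0 -scalerBl coefZ coefXn eqxx mulr1 -fab //.
      by rewrite ltnS ik mulr_natl.
    - rewrite -val_eqE /= in ji.
      by rewrite -scalerBl coefZ coefXn eq_sym (negPf ji) mulr0.
  rewrite ltnS ltnNge ki mul0rn [RHS]big1 // => j _.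
  by rewrite -scalerBl coefZ coefXn gtn_eqF ?mulr0 // (leq_trans _ ki).
rewrite nk; apply: (@ode_unique _ (recip_poly ra)).
- by rewrite recip_poly0 oner_eq0.
- rewrite coefB coefM big_ord1 !recip_poly0 mul1r.
  rewrite /W /E nk big_ord_recl expr0 fact0 invr1 scale1r coefD coef1 coef_sum.
  rewrite [X in 1 + X]big1 ?addr0 ?subrr // => i _.
  rewrite coefZ exprS coefM big_ord1.
  by rewrite [F`_0]coef_poly f0 if_same mul0r mulr0.
have := recip_poly_log_deriv k ra; have := recip_poly_log_deriv k rb.
move: ode; rewrite GE.
set Ga := \sum_(m < k) (\sum_(a <- ra) _) *: _.
set Gb := \sum_(m < k) (\sum_(b <- rb) _) *: _.
set Pa := recip_poly ra; set Pb := recip_poly rb => ode lb la.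
rewrite derivB derivM.
have -> : Pa * (Pb^`() * W + Pb * W^`() - Pa^`()) - Pa^`() * (Pb * W - Pa) =
  Pa * W * (Pb^`() + Gb * Pb) + Pa * Pb * (W^`() - (Gb - Ga) * W) -
  Pb * W * (Pa^`() + Ga * Pa) by ring.
by rewrite dvdp_sub ?dvdp_add ?dvdp_mull.
Qed.

End Exp.

Lemma ps_exp_powersum f rb ra : f 0%N = 0 ->
  (forall m, (0 < m)%N -> m%:R * f m =
     \sum_(b <- rb) b ^+ m - \sum_(a <- ra) a ^+ m) ->
  forall n,
    ps_mul (fun i => (recip_poly rb)`_i) (ps_exp f) n = (recip_poly ra)`_n.
Proof.
move=> f0 fab n.
have /Xn_dvdP/(_ n (ltnSn n)) := ps_exp_powersum_trunc f0 (erefl n.+1) fab.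
rewrite coefB => /eqP; rewrite subr_eq0 => /eqP <-; rewrite coefM.
by apply: eq_bigr => i _; rewrite (ps_exp_coef f0 (n := n.+1)) // ltnS leq_subr.
Qed.
End Series.

(** * Expansions of rational functions *)

(** The coefficients of p and q lie in a number field.  One of its coordinate
    forms over rat does not vanish on the constant term of q; since s has
    rational terms, applying this form to all coefficients preserves the
    relation between p, q and s. *)
Lemma rational_of_algC_expansion (s : nat -> rat) (p q : {poly algC}) :
  q`_0 != 0 ->
  (forall n, ps_mul (fun i => q`_i) (fun i => ratr (s i)) n = p`_n) ->
  exists p' q' : {poly rat},
    q'`_0 != 0 /\ forall n, ps_mul (fun i => q'`_i) s n = p'`_n.
Proof.
move=> q0 qsp; have [Qs [QsC [s1 s1E _]]] := num_field_exists (p ++ q).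
pose p1 i := if (i < size p)%N then s1`_i else 0.
pose q1 i := if (i < size q)%N then s1`_(size p + i) else 0.
have s1n i : (i < size p + size q)%N -> QsC s1`_i = (p ++ q)`_i.
  move=> ilt; rewrite -s1E (nth_map 0) // -(size_map QsC) s1E size_cat //.
have p1E i : QsC (p1 i) = p`_i.
  rewrite /p1; case: ltnP => ip; last by rewrite rmorph0 nth_default.
  by rewrite s1n ?ltn_addr // nth_cat ip.
have q1E i : QsC (q1 i) = q`_i.
  rewrite /q1; case: ltnP => iq; last by rewrite rmorph0 nth_default.
  by rewrite s1n ?ltn_add2l // nth_cat ltnNge leq_addr addKn.
have [i v0] : exists i, coord (vbasis {:Qs}) i (q1 0%N) != 0.
  apply/existsP; apply: contraR q0 => /existsPn v0.
  rewrite -q1E (coord_vbasis (memvf (q1 0%N))) big1 ?rmorph0 // => i _.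
  by have := v0 i; rewrite negbK => /eqP ->; rewrite scale0r.
pose phi := coord (vbasis {:Qs}) i.
exists (\poly_(j < size p) phi (p1 j)), (\poly_(j < size q) phi (q1 j)).
have phi0 : phi 0 = 0 by rewrite /phi linear0.
have p'E n : (\poly_(j < size p) phi (p1 j))`_n = phi (p1 n).
  by rewrite coef_poly /p1; case: ltnP => // _; rewrite phi0.
have q'E n : (\poly_(j < size q) phi (q1 j))`_n = phi (q1 n).
  by rewrite coef_poly /q1; case: ltnP => // _; rewrite phi0.
split=> [|n]; first by rewrite q'E.
rewrite p'E (_ : p1 n = \sum_(j < n.+1) s (n - j)%N *: q1 j).
  rewrite /phi linear_sum; apply: eq_bigr => j _.
  by rewrite q'E linearZ mulrC.
apply: (fmorph_inj QsC); rewrite p1E -qsp rmorph_sum; apply: eq_bigr => j _.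
by rewrite rmorphZ_num q1E mulrC.
Qed.

Lemma expansion_trunc (K : fieldType) (p q : {poly K}) (s : nat -> K)
    (n : nat) :
  (forall n, ps_mul (fun i => q`_i) s n = p`_n) ->
  'X^n %| q * \poly_(i < n) s i - p.
Proof.
move=> qsp; apply/Xn_dvdP => i ilt.
rewrite coefB -qsp coefM; apply/eqP; rewrite subr_eq0; apply/eqP.
by apply: eq_bigr => j _; rewrite coef_poly (leq_ltn_trans (leq_subr _ _) ilt).
Qed.

(** Modulo every power of X, p is q times a truncation of s and p' is q'
    times the same truncation. *)
Lemma expansion_cross (K : fieldType) (p q p' q' : {poly K}) (s : nat -> K) :
  (forall n, ps_mul (fun i => q`_i) s n = p`_n) ->
  (forall n, ps_mul (fun i => q'`_i) s n = p'`_n) ->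
  p * q' = p' * q.
Proof.
move=> qs qs'; apply/eqP; rewrite -subr_eq0; apply/eqP/polyP => n.
have /Xn_dvdP/(_ n (ltnSn n)) -> : 'X^(n.+1) %| p * q' - p' * q;
  last by rewrite coef0.
(* The combination that eliminates the truncated series. *)
have -> : p * q' - p' * q =
  q * (q' * \poly_(i < n.+1) s i - p') - q' * (q * \poly_(i < n.+1) s i - p).
  by ring.
by rewrite dvdp_sub ?dvdp_mull ?expansion_trunc.
Qed.

Lemma ps_mul_morph (K L : nzRingType) (phi : {rmorphism K -> L})
    (f g : nat -> K) (n : nat) :
  phi (ps_mul f g n) = ps_mul (fun i => phi (f i)) (fun i => phi (g i)) n.
Proof. by rewrite rmorph_sum; apply: eq_bigr => i _; rewrite rmorphM. Qed.

Lemma ps_exp_morph (K L : fieldType) (phi : {rmorphism K -> L})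
    (f : nat -> K) (n : nat) :
  phi (ps_exp f n) = ps_exp (fun i => phi (f i)) n.
Proof.
rewrite rmorph_sum; apply: eq_bigr => k _; rewrite fmorph_div rmorph_nat.
congr (_ / _); case: k => k _ /=.
elim: k n => [|k IHk] j /=; first by rewrite rmorph_nat.
by rewrite ps_mul_morph; apply: eq_bigr => i _; rewrite IHk.
Qed.

(** The polynomial X^N p(1 / (D X)), for N at least the degree of p. *)
Definition rev_subst (K : fieldType) (D : K) (N : nat) (p : {poly K}) :=
  \poly_(j < N.+1) (p`_(N - j) / D ^+ (N - j)).

Lemma rev_substE (K L : fieldType) (phi : {rmorphism K -> L}) (D : K) (N : nat)
    (p : {poly K}) (z : L) :
  (size p <= N.+1)%N -> z != 0 ->
  (map_poly phi (rev_subst D N p)).[z] =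
    z ^+ N * (map_poly phi p).[(phi D * z)^-1].
Proof.
move=> pN z0.
rewrite (horner_coef_wide _ (n := N.+1)); last first.
  by rewrite size_map_poly size_poly.
rewrite [X in _ * X](horner_coef_wide _ (n := N.+1)) ?size_map_poly //.
rewrite mulr_sumr [RHS](reindex_inj rev_ord_inj) /=; apply: eq_bigr => j _.
rewrite !coef_map coef_poly ltn_ord /= subSS fmorph_div rmorphXn.
have zz : z ^+ (N - j) * (z ^+ (N - j))^-1 = 1 by rewrite mulfV ?expf_neq0.
rewrite -[in z ^+ N](subnK (leq_ord j)) exprD exprVn exprMn invfM.
rewrite -[LHS]mulr1 -zz.
by ring.
Qed.

Lemma rev_subst_eq0 (K : fieldType) (D : K) (N : nat) (p : {poly K}) :
  (size p <= N.+1)%N -> D != 0 -> (rev_subst D N p == 0) = (p == 0).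
Proof.
move=> pN D0; apply/eqP/eqP => [r0|->]; last first.
  by apply/polyP => i; rewrite coef_poly !coef0 mul0r if_same.
apply/polyP => i; rewrite coef0; have [iN|Ni] := leqP i N; last first.
  by rewrite nth_default // (leq_trans pN).
have := congr1 (fun p : {poly K} => p`_(N - i)%N) r0.
rewrite coef_poly coef0 ltnS leq_subr subKn // => /eqP.
by rewrite mulf_eq0 invr_eq0 expf_eq0 (negPf D0) andbF orbF => /eqP.
Qed.

(** Vanishing outside the zeros of a fixed nonzero v suffices, as the
    natural numbers provide infinitely many points. *)
Lemma poly_eq0_pointwise (K : fieldType) (L : numFieldType)
    (phi : {rmorphism K -> L}) (u : {poly K}) (v : {poly L}) : v != 0 ->
  (forall z, v.[z] != 0 -> (map_poly phi u).[z] = 0) -> u = 0.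
Proof.
move=> v0 uv; apply/eqP; rewrite -(map_poly_eq0 phi).
set w := map_poly _ u; have vw : v * w = 0.
  pose rs : seq L := [seq i%:R | i <- iota 0 (size (v * w))].
  apply: (@roots_geq_poly_eq0 _ _ rs); last by rewrite size_map size_iota.
    apply/allP => x _; rewrite rootE hornerM; have [->|/uv] := eqVneq v.[x] 0.
      by rewrite mul0r.
    by rewrite /w => ->; rewrite mulr0.
  by rewrite map_inj_uniq ?iota_uniq //; exact: (@mulrIn _ 1 (oner_neq0 _)).
by move/eqP: vw; rewrite mulf_eq0 (negPf v0).
Qed.

(** * The product over sets of eigenvalues *)

Section ZetaProduct.
Variables (K : fieldType) (d : nat) (lam : 'I_d -> K) (delta : K) (eps : int).
Hypothesis lam0 : forall i, lam i != 0.
Hypotheses (delta2 : delta ^+ 2 = 1) (d0 : (0 < d)%N).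
Implicit Types S : {set 'I_d}.

Definition lam_set S := \prod_(i in S) lam i.
Definition sgn_set S : int := eps * (-1) ^+ #|S|.
Let D := \prod_i lam i.

(** The value at z of the zeta function of an endomorphism with
    eigenvalues lam. *)
Definition zeta_prod (z : K) : K :=
  \prod_S (1 - delta * lam_set S * z) ^ (- sgn_set S).

Lemma prod_exprz (I : finType) (P : pred I) (F : I -> K) (n : int) :
  (\prod_(i | P i) F i) ^ n = \prod_(i | P i) F i ^ n.
Proof.
apply: (big_morph (fun x : K => x ^ n)) => [x y|]; last exact: exp1rz.
exact: expfzMl.
Qed.

Lemma exprz_sum (I : finType) (P : pred I) (x : K) (n : I -> int) : x != 0 ->
  x ^ (\sum_(i | P i) n i) = \prod_(i | P i) x ^ n i.
Proof.
move=> x0; apply: (big_morph (exprz x)) => [a b|]; last exact: expr0z.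
exact: expfzDr.
Qed.

(** Up to eps this is the expansion of (1 - 1)^d. *)
Lemma sum_sgn_set : \sum_S sgn_set S = 0.
Proof.
rewrite -mulr_sumr (_ : \sum_S _ = \prod_(i < d) (-1 + 1 : int)).
  rewrite (bigD1 (Ordinal d0)) //=.
  by rewrite addNr mul0r mulr0.
rewrite bigA_distr; apply: eq_bigr => S _.
by rewrite -big_mkcond /= prodr_const.
Qed.

(** Up to eps this is the expansion of the product over j of -1 + [j != i],
    whose factors with j != i vanish. *)
Lemma sum_sgn_set_in (i : 'I_d) :
  \sum_(S : {set 'I_d} | i \in S) sgn_set S = if d == 1%N then - eps else 0.
Proof.
rewrite -mulr_sumr.
rewrite (_ : \sum_(S : {set 'I_d} | _) _ = \prod_j (-1 + (j != i)%:R : int)).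
  rewrite (bigD1 i) //= eqxx addr0.
  case: (eqVneq d 1%N) => [d1|d1].
    rewrite big1 ?mulrN ?mulr1 // => j; rewrite -val_eqE /=.
    by have := ltn_ord j; have := ltn_ord i; lia.
  have [j ji] : exists j : 'I_d, j != i.
    have d1' : (1 < d)%N by lia.
    exists (if i == 0%N :> nat then Ordinal d1' else Ordinal d0).
    by rewrite -val_eqE; case: ifP => /= [/eqP->|/negbT]; rewrite // eq_sym.
  by rewrite (bigD1 j) //= ji addNr mul0r !mulr0.
rewrite bigA_distr big_mkcond; apply: eq_bigr => S _.
case: ifP => iS.
  rewrite (eq_bigr (fun j => if j \in S then -1 else 1)) => [|j _].
    by rewrite -big_mkcond /= prodr_const.
  by case: ifP => // jS; case: eqP jS => // ->; rewrite iS.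
by rewrite (bigD1 i) //= iS eqxx mul0r.
Qed.

Lemma lam_set_neq0 S : lam_set S != 0.
Proof. by apply/prodf_neq0 => i _. Qed.

Lemma lam_setC S : lam_set (~: S) * lam_set S = D.
Proof.
rewrite /D (bigID (mem S)) /= mulrC; congr (_ * _).
by apply: eq_bigl => i; rewrite inE.
Qed.

(** The exponent of lam i on the left is [sum_sgn_set_in]. *)
Lemma prod_lam_set : \prod_S lam_set S ^ sgn_set S =
  if d == 1%N then D ^ (- eps) else 1.
Proof.
under eq_bigr => S _ do rewrite prod_exprz.
rewrite (exchange_big_dep xpredT) //=.
under eq_bigr => i _ do rewrite -exprz_sum // sum_sgn_set_in.
by case: ifP => _; [rewrite -prod_exprz | rewrite big1].
Qed.

(** The substitution of 1 / (D z) for z exchanges the factors of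
    complementary sets, up to the monomial - delta / (z lam_S). *)
Lemma zeta_prod_functional (z : K) : z != 0 ->
  zeta_prod (D * z)^-1 =
    (if d == 1%N then D else 1) ^ eps * zeta_prod z ^ ((-1) ^+ d).
Proof.
move=> z0; have delta0 : delta != 0.
  apply/eqP => delta0; move/eqP: delta2.
  by rewrite delta0 expr0n eq_sym oner_eq0.
have D0 : D != 0 by apply/prodf_neq0 => i _.
have factorE S :
    (1 - delta * lam_set (~: S) * (D * z)^-1) ^ (- sgn_set (~: S)) =
    ((- delta / z) ^ (- sgn_set S) * lam_set S ^ sgn_set S *
     (1 - delta * lam_set S * z) ^ (- sgn_set S)) ^ ((-1) ^+ d).
  have -> : - sgn_set (~: S) = - sgn_set S * (-1) ^+ d.
    rewrite mulNr -mulrA -exprD; congr (- (_ * _)).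
    rewrite cardsCs finset.setCK card_ord -signr_odd oddB; last first.
      by rewrite -[leqRHS](card_ord d) max_card.
    by rewrite addbC -oddD signr_odd.
  rewrite -exprz_exp; congr (_ ^ _).
  have -> : lam_set S ^ sgn_set S = (lam_set S)^-1 ^ (- sgn_set S).
    by rewrite exprz_inv opprK.
  rewrite -!expfzMl; congr (_ ^ _).
  rewrite -(lam_setC S); have := lam_set_neq0 S; have := lam_set_neq0 (~: S).
  move: (lam_set (~: S)) (lam_set S) => a b a0 b0.
  (* The constant 1 on the left is the product delta^2 on the right. *)
  transitivity (- delta / z / b + delta ^+ 2); last by field; rewrite z0 b0.
  by rewrite delta2; field; rewrite z0 a0 b0.
rewrite /zeta_prod (reindex_inj (@finset.setC_inj _)) /=.
under eq_bigr => S _ do rewrite factorE.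
rewrite -prod_exprz !big_split /= -exprz_sum; last first.
  by rewrite mulf_neq0 ?invr_eq0 ?oppr_eq0.
rewrite sumrN sum_sgn_set oppr0 expr0z mul1r prod_lam_set expfzMl.
congr (_ * _); case: eqVneq => [->|_]; last by rewrite !exp1rz.
by rewrite exprz_exp expr1 mulrN1 opprK.
Qed.

End ZetaProduct.

(** * The zeta function and its functional equation *)

Section ZetaRational.
Variables (K : numFieldType) (d : nat) (lam : 'I_d -> K).
Variables (delta : K) (eps : int).
Hypothesis eps_unit : eps = 1 \/ eps = -1.

Definition signed_roots (e : int) : seq K :=
  [seq delta * lam_set lam A
     | A : {set 'I_d} <- index_enum {set 'I_d} & sgn_set eps A == e].

Lemma sgn_set_unit (S : {set 'I_d}) : sgn_set eps S = 1 \/ sgn_set eps S = -1.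
Proof.
rewrite /sgn_set -signr_odd.
by case: eps_unit => ->; case: (odd _); rewrite ?(expr0, expr1) ?(mulr1, mul1r);
  auto.
Qed.

Lemma sgn_set_neq1 (S : {set 'I_d}) :
  (sgn_set eps S != 1) = (sgn_set eps S == -1).
Proof. by case: (sgn_set_unit S) => ->. Qed.

Lemma zeta_prodE (z : K) :
  zeta_prod lam delta eps z =
    (recip_poly (signed_roots (-1))).[z] / (recip_poly (signed_roots 1)).[z].
Proof.
rewrite /zeta_prod (bigID (fun S => sgn_set eps S == 1)) /= mulrC.
rewrite (eq_bigl _ _ sgn_set_neq1) /recip_poly !horner_prod.
rewrite !big_map !big_filter.
rewrite -prodfV; congr (_ * _); apply: eq_bigr => S /eqP ->.
  by rewrite opprK expr1z hornerD hornerN hornerZ hornerX hornerC.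
by rewrite exprN1 hornerD hornerN hornerZ hornerX hornerC.
Qed.

(** The expansion of the product of the 1 - lam_i^m over subsets, sorted by
    the sign of the coefficient. *)
Lemma powersum_signed_roots (m : nat) :
  eps%:~R * delta ^+ m * \prod_i (1 - lam i ^+ m) =
  \sum_(b <- signed_roots 1) b ^+ m - \sum_(a <- signed_roots (-1)) a ^+ m.
Proof.
under eq_bigr => i _ do rewrite addrC.
rewrite bigA_distr mulr_sumr !big_map !big_filter.
rewrite (bigID (fun S => sgn_set eps S == 1)) /= (eq_bigl _ _ sgn_set_neq1).
have termE (S : {set 'I_d}) :
    eps%:~R * delta ^+ m * (\prod_i (if i \in S then - lam i ^+ m else 1)) =
    (sgn_set eps S)%:~R * (delta * lam_set lam S) ^+ m.
  rewrite -big_mkcond /= prodrN prodrXl /sgn_set intrM rmorphXn /= rmorphN1.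
  by rewrite exprMn; ring.
by congr (_ + _); rewrite -?sumrN; apply: eq_bigr => S /eqP eS;
  rewrite termE eS ?mul1r // mulN1r.
Qed.
End ZetaRational.

Lemma frac_numden (K : idomainType) (z : {fraction K}) :
  z = (\n_(repr z))%:F / (\d_(repr z))%:F.
Proof.
have d0 : (\d_(repr z))%:F != 0 by rewrite tofrac_eq0 denom_ratioP.
apply: (mulIf d0); rewrite divfK // -{1}[z]reprK.
rewrite -[LHS]/(FracField.mul _ _); apply/eqP; rewrite !piE /FracField.mulf.
rewrite /= FracField.equivfE !numden_Ratio;
  rewrite ?mulf_neq0 ?oner_eq0 ?denom_ratioP //.
by rewrite !mulr1 mulrC.
Qed.

Section FracComp.
Variable K : fieldType.
Implicit Types p q : {poly K}.

Let phi : {rmorphism K -> {fraction {poly K}}} :=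
  (@FracField.tofrac {poly K}) \o (@polyC K).

Lemma horner_tofracX p : (map_poly phi p).['X%:F] = p%:F.
Proof.
by rewrite map_poly_comp /= horner_map /= -[p in RHS]comp_polyXr.
Qed.

Lemma tofrac_rev_subst (D : K) (N : nat) p : (size p <= N.+1)%N ->
  (rev_subst D N p)%:F = 'X%:F ^+ N * (map_poly phi p).[(D *: 'X)%:F^-1].
Proof.
move=> pN; rewrite -horner_tofracX rev_substE //; last first.
  by rewrite tofrac_eq0 polyX_eq0.
by rewrite -mul_polyC rmorphM.
Qed.

(** Composition is defined through the representative of the fraction; any
    other numerator p and denominator q give the same value, because a
    nonzero polynomial does not vanish at 1 / (D X). *)
Lemma frac_comp_rev_subst (D : K) (N : nat) p q : D != 0 -> q != 0 ->
  (size p <= N.+1)%N -> (size q <= N.+1)%N ->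
  frac_comp (p%:F / q%:F) (D *: 'X)%:F^-1 =
    (rev_subst D N p)%:F / (rev_subst D N q)%:F.
Proof.
move=> D0 q0 pN qN; set G := (D *: 'X)%:F^-1; set z := p%:F / q%:F.
have horner_neq0 r : r != 0 -> (map_poly phi r).[G] != 0.
  move=> r0; have := tofrac_rev_subst D (leqnSn (size r)); rewrite -/G => rE.
  apply: contra r0 => /eqP r0; move: rE; rewrite r0 mulr0 => /eqP.
  by rewrite tofrac_eq0 rev_subst_eq0.
have zq : \n_(repr z) * q = p * \d_(repr z).
  apply/eqP; rewrite -tofrac_eq !rmorphM /=.
  rewrite -eqr_div ?tofrac_eq0 ?denom_ratioP //.
  by rewrite -frac_numden.
rewrite !tofrac_rev_subst // invfM mulrACA divff ?mul1r; last first.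
  by rewrite expf_neq0 // tofrac_eq0 polyX_eq0.
have -> : frac_comp z G =
    (map_poly phi \n_(repr z)).[G] / (map_poly phi \d_(repr z)).[G] by [].
apply/eqP; rewrite eqr_div ?horner_neq0 ?denom_ratioP //.
by rewrite -!hornerM -!rmorphM zq.
Qed.
End FracComp.

Section Assembly.
Variables (R : realType) (d : nat) (M : 'M[int]_d).
Variables (sigma tau : nat) (Q : {poly int}).
Hypothesis char_fact :
  char_poly M = ('X - 1%:P) ^+ sigma * ('X + 1%:P) ^+ tau * Q.
Hypotheses (Q1 : Q.[1] != 0) (QN1 : Q.[-1] != 0).
Variable lam : 'I_d -> algC.
Hypothesis char_lam : char_poly (map_mx intr M) = \prod_i ('X - (lam i)%:P).

Let delta : algC := (zeta_delta M tau)%:~R.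
Let eps := zeta_eps M sigma tau.
Let P := recip_poly (signed_roots lam delta eps (-1)).
Let U := recip_poly (signed_roots lam delta eps 1).

(** The product formula with denominators cleared: m times the m-th
    coefficient of the exponent is a_m, the signed power sum of the
    delta lam_S. *)
Lemma zeta_series_algC n :
  ps_mul (fun i => U`_i) (fun i => ratr (zeta_series R M i)) n = P`_n.
Proof.
pose f m : rat := if m == 0%N then 0 else (num_isolated_fix R M m)%:R / m%:R.
have -> : (fun i => ratr (zeta_series R M i)) =
    ps_exp (fun i => ratr (f i)) :> (nat -> algC).
  by apply/funext => i; exact: ps_exp_morph.
apply: ps_exp_powersum; first by rewrite rmorph0.
move=> m m0; rewrite -powersum_signed_roots; last first.
  exact: (zeta_eps_unit char_fact Q1 QN1).
rewrite /f /= gtn_eqF // fmorph_div /= !ratr_nat.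
rewrite mulrC divfK ?pnatr_eq0 -?lt0n //.
rewrite num_isolated_fixE pmulrn (abs_det_1sub_exp char_fact QN1 m0).
rewrite !intrM rmorphXn /= -(det_1sub_exp char_lam m0) -map_mx_exp.
by rewrite -det_map_mx raddfB /= map_mx1.
Qed.

Hypotheses (d_gt0 : (0 < d)%N) (detM0 : \det M != 0).

Lemma prod_eigenvalues : \prod_i lam i = (\det M)%:~R.
Proof.
have := horner_char_poly (map_mx intr M) (0 : algC).
rewrite char_lam horner_prod (raddf0 (@scalar_mx _ d)) sub0r -scaleN1r.
rewrite detZ det_map_mx.
under eq_bigr => i _ do rewrite hornerXsubC sub0r.
rewrite prodrN card_ord => /mulfI; apply.
by rewrite expf_eq0 oppr_eq0 oner_eq0 andbF.
Qed.

Let D : rat := (\det M)%:~R.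
Let B : rat := if d == 1%N then D else 1.

(** Transfers the product formula to any rational numerator p and
    denominator q of the zeta series, at the points where the product has no
    pole. *)
Lemma zeta_prod_rat (p q : {poly rat}) (z : algC) :
  (forall n, ps_mul (fun i => q`_i) (zeta_series R M) n = p`_n) -> U.[z] != 0 ->
  (map_poly ratr p).[z] = zeta_prod lam delta eps z * (map_poly ratr q).[z].
Proof.
move=> qsp Uz; rewrite zeta_prodE; last exact: (zeta_eps_unit char_fact Q1 QN1).
have pqU : P * map_poly ratr q = map_poly ratr p * U.
  apply: (expansion_cross zeta_series_algC) => n.
  rewrite coef_map -qsp /= (ps_mul_morph (ratr : {rmorphism rat -> algC})).
  apply: eq_bigr => i _ /=.
  by rewrite coef_map.
rewrite mulrAC -/P -/U; apply: (mulIf Uz); rewrite divfK //.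
by rewrite -!hornerM pqU.
Qed.

(** After clearing denominators the equation is an identity between
    polynomials over rat; it is checked at the complex points where neither
    numerator nor denominator of the product, nor the variable, vanishes. *)
Lemma functional_equation (p q : {poly rat}) : q.[0] != 0 ->
  (forall n, ps_mul (fun i => q`_i) (zeta_series R M) n = p`_n) ->
  frac_comp (p%:F / q%:F) (D *: 'X)%:F^-1 =
       (B ^ eps)%:P%:F * (p%:F / q%:F) ^ ((-1) ^+ d).
Proof.
move=> q0 qsp.
have qn0 : q != 0 by apply: contraNneq q0 => ->; rewrite horner0.
have pn0 : p != 0.
  suff p0 : p`_0 != 0 by apply: contraNneq p0 => ->; rewrite coef0.
  rewrite -qsp /ps_mul big_ord1 /zeta_series /ps_exp big_ord1 iter0.
  by rewrite /ps_one eqxx fact0 !divr1 -horner_coef0.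
have [pN qN] : (size p <= (maxn (size p) (size q)).+1)%N /\
    (size q <= (maxn (size p) (size q)).+1)%N.
  by rewrite !leqW ?leq_maxl ?leq_maxr.
have D0 : D != 0 by rewrite intr_eq0.
rewrite (frac_comp_rev_subst D0 qn0 pN qN).
set N := maxn _ _ in pN qN *.
set a := rev_subst D N p; set b := rev_subst D N q.
have bn0 : b != 0 by rewrite rev_subst_eq0.
pose v := 'X * (P * U).
have recip_neq0 r : recip_poly r != 0 :> {poly algC}.
  by apply: contra_eq_neq (recip_poly0 r) => ->; rewrite coef0 eq_sym oner_eq0.
have vn0 : v != 0 by rewrite !mulf_neq0 ?polyX_eq0 ?recip_neq0.
have eps_unit := zeta_eps_unit char_fact Q1 QN1.
have lam0 i : lam i != 0.
  have : \prod_i lam i != 0 by rewrite prod_eigenvalues intr_eq0.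
  by apply: contraNneq => li; rewrite (bigD1 i) //= li mul0r.
have delta2 : delta ^+ 2 = 1.
  by rewrite /delta -rmorphXn /= (zeta_delta_sqr char_fact QN1).
have pointwise := @poly_eq0_pointwise _ _ (ratr : {rmorphism rat -> algC}) _ v.
have valE z : v.[z] != 0 -> exists h,
  [/\ h != 0, (map_poly ratr p).[z] = h * (map_poly ratr q).[z]
   & (map_poly ratr a).[z] =
        ratr (B ^ eps) * h ^ ((-1) ^+ d) * (map_poly ratr b).[z]].
  rewrite !hornerM hornerX !mulf_eq0 !negb_or => /and3P[z0 Pz Uz].
  have h0 : zeta_prod lam delta eps z != 0.
    by rewrite zeta_prodE // mulf_neq0 ?invr_eq0.
  exists (zeta_prod lam delta eps z); split => //; first exact: zeta_prod_rat.
  have DE : ratr D = \prod_i lam i :> algC.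
    by rewrite prod_eigenvalues /D rmorph_int.
  have hw : zeta_prod lam delta eps (ratr D * z)^-1 =
      ratr (B ^ eps) * zeta_prod lam delta eps z ^ ((-1) ^+ d).
    rewrite DE zeta_prod_functional // fmorphXz /B -DE; congr (_ ^ _ * _).
    by case: ifP => _; rewrite ?rmorph1.
  have B0 : B != 0 by rewrite /B; case: ifP.
  (* With the inverse of 0 equal to 0, a zero of U at 1 / (D z) would make
     the left-hand side of [hw] vanish, but its right-hand side does not. *)
  have Uw : U.[(ratr D * z)^-1] != 0.
    apply/eqP => Uw; move/eqP: hw; rewrite zeta_prodE // -/U Uw invr0 mulr0.
    rewrite eq_sym mulf_eq0 fmorph_eq0 !expfz_eq0.
    by rewrite (negPf B0) (negPf h0) !andbF.
  rewrite !rev_substE // (zeta_prod_rat qsp Uw) hw.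
  by rewrite mulrCA.
rewrite -signr_odd in valE *; case: (odd d) valE => /= valE.
- rewrite expr1 in valE *; rewrite exprN1 invf_div mulrA.
  apply/eqP; rewrite eqr_div ?tofrac_eq0 // -!rmorphM /= tofrac_eq -subr_eq0.
  apply/eqP; apply: (pointwise _ vn0) => z /valE[h [h0 pE aE]].
  rewrite rmorphB !rmorphM /= map_polyC !hornerE /= pE aE exprN1.
  move: (ratr (B ^ eps)) (_.[z]) (_.[z]) => c x y.
  by field.
- rewrite expr0 in valE *; rewrite expr1z mulrA.
  apply/eqP; rewrite eqr_div ?tofrac_eq0 // -!rmorphM /= tofrac_eq -subr_eq0.
  apply/eqP; apply: (pointwise _ vn0) => z /valE[h [h0 pE aE]].
  rewrite rmorphB !rmorphM /= map_polyC !hornerE /= pE aE expr1z.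
  move: (ratr (B ^ eps)) (_.[z]) (_.[z]) => c x y.
  by ring.
Qed.
End Assembly.

Theorem corollary1 (R : realType) (d : nat) (hd : (1 <= d)%N)
    (M : 'M[int]_d) (hD : \det M != 0)
    (sigma tau : nat) (Q : {poly int})
    (hchar : char_poly M = ('X - 1%:P) ^+ sigma * ('X + 1%:P) ^+ tau * Q)
    (hQ1 : Q.[1] != 0) (hQN1 : Q.[-1] != 0) :
  let D : rat := (\det M)%:~R in
  let B : rat := if d == 1%N then D else 1 in
  (exists zeta : {fraction {poly rat}},
     expansion_at0 zeta (zeta_series R M)) /\
  (forall zeta : {fraction {poly rat}},
     expansion_at0 zeta (zeta_series R M) ->
     frac_comp zeta (D *: 'X)%:F^-1 =
       (B ^ zeta_eps M sigma tau)%:P%:F * zeta ^ ((-1) ^+ d)).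
Proof.
move=> D B; have [lam lamE] := eigenvalues_exist (map_mx intr M).
split; last first.
  move=> _ [p [q [q0 -> qsp]]].
  exact: (functional_equation hchar hQ1 hQN1 lamE hd hD q0 qsp).
have := zeta_series_algC R hchar hQ1 hQN1 lamE.
move=> /rational_of_algC_expansion[|p [q [q0 qsp]]].
  by rewrite recip_poly0 oner_eq0.
by exists (p%:F / q%:F), p, q; rewrite horner_coef0.
Qed.
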